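(* Let $n \geq 5$. If $x$ is a top-dimensional zero-divisor of $A_n$, then $x$ is of the form $(a,i_{n-1} a)$ or $(a, -i_{n-1} a)$ for some top-dimensional zero-divisor $a$ of $A_{n-1}$.
   Context: The Cayley-Dickson algebras $A_n$ are the finite-dimensional, generally non-associative, real algebras with linear involution $x\mapsto x^*$ defined inductively: $A_0=\mathbb{R}$ with trivial involution, and $A_n = A_{n-1}\times A_{n-1}$ additively, with multiplication $(a,b)(c,d) = (ac - d^* b,\ da + bc^* )$ and involution $(a,b)^* = (a^*,-b)$. For $n\ge 1$, $i_n=(0,1)\in A_n$. For $x\in A_n$, $\operatorname{Ann}(x)=\{y\in A_n : xy=0\}$. For $n\geq 2$, an element of $A_n$ is a top-dimensional zero-divisor if its annihilator has real dimension $2^n-4n+4$. *)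

(* Defs.v *)
From HB Require Import structures.
From mathcomp Require Import all_boot all_order all_algebra.
From mathcomp Require Import reals.

Set Implicit Arguments.
Unset Strict Implicit.
Unset Printing Implicit Defensive.

Import Order.TTheory GRing.Theory Num.Theory.

Local Open Scope ring_scope.

Fixpoint CD (R : realType) (n : nat) : vectType R :=
  match n with
  | 0 => R^o
  | m.+1 => (CD R m * CD R m)%type
  end.

Fixpoint cd_conj (R : realType) (n : nat) : CD R n -> CD R n :=
  match n with
  | 0 => fun x => x
  | m.+1 => fun x : CD R m * CD R m => (cd_conj x.1, - x.2)
  end.

Fixpoint cd_mul (R : realType) (n : nat) : CD R n -> CD R n -> CD R n :=
  match n with
  | 0 => fun x y : R => x * y
  | m.+1 => fun x y : CD R m * CD R m =>
      (cd_mul x.1 y.1 - cd_mul (cd_conj y.2) x.2,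
       cd_mul y.2 x.1 + cd_mul x.2 (cd_conj y.1))
  end.

Fixpoint cd_one (R : realType) (n : nat) : CD R n :=
  match n with
  | 0 => (1 : R)
  | m.+1 => (cd_one R m, 0)
  end.

(* [cd_i R m] is i_(m+1): the imaginary unit (0, 1) lives in [CD R m.+1]. *)
Definition cd_i (R : realType) (m : nat) : CD R m.+1 := (0, cd_one R m).

Lemma cd_conj_is_linear (R : realType) (n : nat) :
  linear (@cd_conj R n).
Proof.
elim: n => [|n IHn] // k [a b] [c d] /=.
by congr (_, _); rewrite ?IHn //= opprD scalerN.
Qed.

Lemma cd_mul_is_bilinear (R : realType) (n : nat) :
  (forall x : CD R n, linear (cd_mul x)) /\
  (forall y : CD R n, linear (fun x => cd_mul x y)).
Proof.
elim: n => [|n [IHr IHl]].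
  split=> x k y z /=; first by rewrite mulrDr scalerAr.
  by rewrite mulrDl scalerAl.
split=> -[a b] k [c d] [e f] /=; congr (_, _); rewrite /= ?cd_conj_is_linear.
- by rewrite IHr IHl opprD addrACA scalerBr.
- by rewrite IHr IHl addrACA scalerDr.
- by rewrite IHr IHl opprD addrACA scalerBr.
- by rewrite IHr IHl addrACA scalerDr.
Qed.

HB.instance Definition _ (R : realType) (n : nat) (x : CD R n) :=
  GRing.isLinear.Build R (CD R n) (CD R n) *:%R (cd_mul x)
    ((cd_mul_is_bilinear R n).1 x).

Definition Ann (R : realType) (n : nat) (x : CD R n) : {vspace CD R n} :=
  lker (linfun (cd_mul x)).

Lemma mem_Ann (R : realType) (n : nat) (x y : CD R n) :
  reflect (cd_mul x y = 0) (y \in Ann x).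
Proof. by rewrite memv_ker lfunE; exact: eqP. Qed.

(* The equation is in [int]: in [nat] the truncated 2 ^ n - 4 * n + 4 would be
   4 instead of 0 at n = 2, 3. *)
Definition top_dimensional_zero_divisor (R : realType) (n : nat) (x : CD R n) :=
  (\dim (Ann x))%:Z = 2 ^+ n - 4 * n%:Z + 4.

(* Main.v *)
Require Import Defs.
From HB Require Import structures.
From mathcomp Require Import all_boot all_order all_algebra.
From mathcomp Require Import reals.
From mathcomp Require Import ring lra zify.

Set Implicit Arguments.
Unset Strict Implicit.
Unset Printing Implicit Defensive.

Import Order.TTheory GRing.Theory Num.Theory.

Local Open Scope ring_scope.

(** Put j = i_(n-1) in A_(n-1), let C be the span of 1 and j, and write
x = (a, b), k = (c, d) for elements of A_n = A_(n-1) x A_(n-1).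

Left and right multiplications have adjoints for the Euclidean inner product,
so a nonzero zero-divisor and everything it kills are orthogonal to 1 and to
i_n ([zero_divisor_pure], [Ann_pure]): a, b, c, d are imaginary, and x k = 0
reads  a c + d b = 0,  d a = b c.

Multiplication by an element orthogonal to C anticommutes with multiplication
by j.  Therefore, when a and b are orthogonal to C, the operator of left
multiplication by x nearly splits: with u = a - j b and v = a + j b, it acts
up to C as multiplication by u on c - j d and as multiplication by v on
c + j d ([mul_split_mem_C]).  Writing D(n) = 2^n - 4n + 4, there are three
possibilities for x.

- If a or b has a component along j, then c + j d, taken modulo C, determines
  k in Ann x, so dim Ann x <= 2^(n-1) - 2 ([dim_Ann_i_component]).
- If a and b are orthogonal to C and u, v are nonzero, the splitting gives
  dim Ann x <= dim Ann u + dim Ann v + 6 ([dim_Ann_pure]).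
- If v = 0 or u = 0, then b = j a or b = - j a, and
  dim Ann x <= dim Ann a + 2^(n-1) - 4 ([dim_Ann_double]).

Suppose that D(n-1) bounds the dimension of every annihilator of a nonzero
element of A_(n-1), with n >= 5.  Then the first two possibilities give a
dimension strictly below D(n), and the third gives at most D(n), because
D(n) = D(n-1) + 2^(n-1) - 4 ([Ann_dichotomy]).  By induction D(n) is an upper
bound for all n >= 4 ([Ann_bound_ge4]), the case n = 4 being that of pairs of
octonions, where norms are multiplicative ([dim_Ann_composition_double]).  An
element attaining D(n) is then of the third kind, and dim Ann a is squeezed
to D(n-1). *)

(** * The Euclidean inner product *)

Fixpoint ip (R : realType) (n : nat) : CD R n -> CD R n -> R :=
  match n with
  | 0 => fun x y : R => x * y
  | m.+1 => fun x y : CD R m * CD R m => ip x.1 y.1 + ip x.2 y.2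
  end.

Lemma pair_ext (T1 T2 : Type) (p q : T1 * T2) : p.1 = q.1 -> p.2 = q.2 -> p = q.
Proof. by case: p q => [p1 p2] [q1 q2] /= -> ->. Qed.

Section InnerProduct.
Variable R : realType.

Lemma ipC n (x y : CD R n) : ip x y = ip y x.
Proof. by elim: n x y => [|n IH] x y /=; [exact: mulrC | rewrite IH [X in _ + X]IH]. Qed.

Lemma ipDl n (x y z : CD R n) : ip (x + y) z = ip x z + ip y z.
Proof.
elim: n x y z => [|n IH] x y z /=; first exact: mulrDl.
by rewrite !IH addrACA.
Qed.

Lemma ipZl n k (x z : CD R n) : ip (k *: x) z = k * ip x z.
Proof.
elim: n x z => [|n IH] x z /=; first by rewrite mulrA.
by rewrite !IH mulrDr.
Qed.

Lemma ipDr n (x y z : CD R n) : ip x (y + z) = ip x y + ip x z.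
Proof. by rewrite ipC ipDl !(ipC x). Qed.

Lemma ipZr n k (x z : CD R n) : ip x (k *: z) = k * ip x z.
Proof. by rewrite ipC ipZl (ipC x). Qed.

Lemma ipNl n (x z : CD R n) : ip (- x) z = - ip x z.
Proof. by rewrite -scaleN1r ipZl mulN1r. Qed.

Lemma ipNr n (x z : CD R n) : ip x (- z) = - ip x z.
Proof. by rewrite ipC ipNl (ipC x). Qed.

Lemma ip0l n (z : CD R n) : ip 0 z = 0.
Proof. by rewrite -(scale0r (0 : CD R n)) ipZl mul0r. Qed.

Lemma ip0r n (z : CD R n) : ip z 0 = 0.
Proof. by rewrite ipC ip0l. Qed.

Definition ipE := (ipDl, ipDr, ipZl, ipZr, ipNl, ipNr, ip0l, ip0r).

Lemma ip_ge0 n (x : CD R n) : 0 <= ip x x.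
Proof.
by elim: n x => [|n IH] x /=; [rewrite -expr2 sqr_ge0 | rewrite addr_ge0].
Qed.

Lemma ip_eq0 n (x : CD R n) : (ip x x == 0) = (x == 0).
Proof.
elim: n x => [|n IH] x /=; first by rewrite mulf_eq0 orbb.
by case: x => x1 x2; rewrite paddr_eq0 ?ip_ge0 //= !IH.
Qed.

Lemma ip_gt0 n (x : CD R n) : (0 < ip x x) = (x != 0).
Proof. by rewrite lt0r ip_ge0 ip_eq0 andbT. Qed.

(** Turns an identity between vectors into one between real numbers, where
linear arithmetic applies. *)
Lemma cd_ext n (x y : CD R n) : (forall w, ip x w = ip y w) -> x = y.
Proof.
move=> E; apply/eqP; rewrite -subr_eq0 -ip_eq0; apply/eqP.
by rewrite ipDl ipNl E subrr.
Qed.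

End InnerProduct.

(** * Bilinearity, conjugation and adjoints *)

Section Algebra.
Variable R : realType.

Lemma cd_mulDl n (x y z : CD R n) : cd_mul (x + y) z = cd_mul x z + cd_mul y z.
Proof. by have := (cd_mul_is_bilinear R n).2 z 1 x y; rewrite !scale1r. Qed.

Lemma cd_mulZl n k (x z : CD R n) : cd_mul (k *: x) z = k *: cd_mul x z.
Proof. 
have E := (cd_mul_is_bilinear R n).2 z.
have E0 : cd_mul 0 z = 0 by have := E (-1) 0 0; rewrite scaler0 addr0 scaleN1r addNr.
by have := E k x 0; rewrite !addr0 E0 addr0.
Qed.

Lemma cd_mulDr n (x y z : CD R n) : cd_mul x (y + z) = cd_mul x y + cd_mul x z.
Proof. exact: linearD. Qed.

Lemma cd_mulZr n k (x z : CD R n) : cd_mul x (k *: z) = k *: cd_mul x z.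
Proof. exact: linearZ. Qed.

Lemma cd_mulNl n (x z : CD R n) : cd_mul (- x) z = - cd_mul x z.
Proof. by rewrite -scaleN1r cd_mulZl scaleN1r. Qed.

Lemma cd_mulNr n (x z : CD R n) : cd_mul x (- z) = - cd_mul x z.
Proof. exact: linearN. Qed.

Lemma cd_mul0l n (z : CD R n) : cd_mul 0 z = 0.
Proof. by rewrite -(scale0r (0 : CD R n)) cd_mulZl !scale0r. Qed.

Lemma cd_mul0r n (z : CD R n) : cd_mul z 0 = 0.
Proof. exact: linear0. Qed.

Definition cd_mulE :=
  (cd_mulDl, cd_mulDr, cd_mulZl, cd_mulZr, cd_mulNl, cd_mulNr, cd_mul0l, cd_mul0r).

Lemma cd_conjD n (x y : CD R n) : cd_conj (x + y) = cd_conj x + cd_conj y.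
Proof. by have := cd_conj_is_linear 1 x y; rewrite !scale1r. Qed.

Lemma cd_conjZ n k (x : CD R n) : cd_conj (k *: x) = k *: cd_conj x.
Proof.
have E0 : cd_conj (0 : CD R n) = 0.
  by have := cd_conj_is_linear (-1) (0 : CD R n) 0; rewrite scaler0 addr0 scaleN1r addNr.
by have := cd_conj_is_linear k x 0; rewrite !addr0 E0 addr0.
Qed.

Lemma cd_conjN n (x : CD R n) : cd_conj (- x) = - cd_conj x.
Proof. by rewrite -scaleN1r cd_conjZ scaleN1r. Qed.

Lemma cd_conj0 n : cd_conj (0 : CD R n) = 0.
Proof. by rewrite -(scale0r (0 : CD R n)) cd_conjZ !scale0r. Qed.

Lemma cd_conjK n (x : CD R n) : cd_conj (cd_conj x) = x.
Proof.
by elim: n x => [|n IH] // [a b] /=; rewrite IH opprK.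
Qed.

Lemma ip_conj n (x y : CD R n) : ip (cd_conj x) (cd_conj y) = ip x y.
Proof. by elim: n x y => [|n IH] //= x y; rewrite IH ipNl ipNr opprK. Qed.

Lemma ip_conjl n (x y : CD R n) : ip (cd_conj x) y = ip x (cd_conj y).
Proof. by rewrite -ip_conj cd_conjK. Qed.

Lemma cd_conj1 n : cd_conj (cd_one R n) = cd_one R n.
Proof. by elim: n => [|n IH] //=; rewrite IH oppr0. Qed.

Lemma cd_mul1r n (x : CD R n) : cd_mul x (cd_one R n) = x.
Proof.
elim: n x => [|n IH] /= x; first exact: mulr1.
by case: x => a b /=; rewrite cd_conj0 cd_conj1 !cd_mul0l !IH subr0 add0r.
Qed.

Lemma cd_mul1l n (x : CD R n) : cd_mul (cd_one R n) x = x.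
Proof.
elim: n x => [|n IH] /= x; first exact: mul1r.
by case: x => a b /=; rewrite cd_mul0r cd_mul0l cd_mul1r IH subr0 addr0.
Qed.

Lemma cd_conjM n (x y : CD R n) :
  cd_conj (cd_mul x y) = cd_mul (cd_conj y) (cd_conj x).
Proof.
elim: n x y => [|n IH] /=; first by move=> x y; exact: mulrC.
move=> [a b] [c d] /=.
by rewrite cd_conjD !cd_conjN !IH !cd_conjK !cd_mulE opprK opprD [X in (_, X) = _]addrC.
Qed.


(** Both adjunctions are needed at the same time: the left one for pairs uses
the right one for their components.  Conjugation exchanges the two. *)
Lemma ip_mul n (x y z : CD R n) :
  ip (cd_mul x y) z = ip y (cd_mul (cd_conj x) z) /\
  ip (cd_mul x y) z = ip x (cd_mul z (cd_conj y)).
Proof.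
elim: n x y z => [|n IH] x y z.
  by split=> /=; [rewrite mulrCA mulrA | rewrite -mulrA (mulrC y)].
have IHl (p q r : CD R n) := (IH p q r).1.
have IHr (p q r : CD R n) := (IH p q r).2.
have L (p q r : CD R n.+1) : ip (cd_mul p q) r = ip q (cd_mul (cd_conj p) r).
  case: p q r => [a b] [c d] [e f] /=.
  rewrite !ipE !cd_mulE ?cd_conjN ?cd_conjK !ipE.
  have -> : ip (cd_mul (cd_conj d) b) e = ip d (cd_mul b (cd_conj e)).
    by rewrite IHr -ip_conj cd_conjK cd_conjM cd_conjK.
  have -> : ip (cd_mul b (cd_conj c)) f = ip c (cd_mul (cd_conj f) b).
    by rewrite IHl -ip_conj cd_conjK cd_conjM cd_conjK.
  by rewrite (IHl a c) (IHr d a); ring.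
by split=> //; rewrite -ip_conj cd_conjM L cd_conjK -[RHS]ip_conj cd_conjM cd_conjK.
Qed.

Lemma ip_mull n (x y z : CD R n) : ip (cd_mul x y) z = ip y (cd_mul (cd_conj x) z).
Proof. exact: (ip_mul x y z).1. Qed.

Lemma ip_mulr n (x y z : CD R n) : ip (cd_mul x y) z = ip x (cd_mul z (cd_conj y)).
Proof. exact: (ip_mul x y z).2. Qed.

Lemma cd_conjE n (x : CD R n) : cd_conj x = (2 * ip x (cd_one R n)) *: cd_one R n - x.
Proof.
elim: n x => [|n IH] x /=; first by rewrite /GRing.scale /=; ring.
by apply: pair_ext; rewrite /= ?scaler0 ?sub0r // ip0r addr0 IH.
Qed.

Lemma cd_mul_conj n (x : CD R n) :
  cd_mul x (cd_conj x) = ip x x *: cd_one R n /\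
  cd_mul (cd_conj x) x = ip x x *: cd_one R n.
Proof.
elim: n x => [|n IH] x; first by split=> /=; rewrite /GRing.scale /= mulr1.
case: x => a b /=; rewrite !cd_conjK !cd_conjN !cd_mulE !opprK.
rewrite (IH a).1 (IH a).2 (IH b).2 -scalerDl.
by rewrite (addrC (- _)) !subrr; split; apply: pair_ext; rewrite /= ?scaler0.
Qed.

Lemma cd_conj_imag n (x : CD R n) : ip x (cd_one R n) = 0 -> cd_conj x = - x.
Proof. by move=> x0; rewrite cd_conjE x0 mulr0 scale0r sub0r. Qed.

Lemma ip_conj1 n (x : CD R n) : ip (cd_conj x) (cd_one R n) = ip x (cd_one R n).
Proof. by rewrite ip_conjl cd_conj1. Qed.

Lemma ip11 n : ip (cd_one R n) (cd_one R n) = 1.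
Proof. by elim: n => [|n IH] /=; rewrite ?mulr1 // ip0l addr0. Qed.

Lemma cd_conjM_im n (a b : CD R n) :
  ip a (cd_one R n) = 0 -> ip b (cd_one R n) = 0 -> cd_conj (cd_mul a b) = cd_mul b a.
Proof. by move=> a0 b0; rewrite cd_conjM !cd_conj_imag // !cd_mulE opprK. Qed.

Lemma cd_anticomm n (a b : CD R n) :
  ip a (cd_one R n) = 0 -> ip b (cd_one R n) = 0 ->
  cd_mul b a = - (2 * ip a b) *: cd_one R n - cd_mul a b.
Proof.
move=> a0 b0; rewrite -cd_conjM_im // cd_conjE ip_mull cd_mul1r cd_conj_imag //.
by rewrite ipNr (ipC b) mulrN.
Qed.

Lemma ip_mul1 n (a c : CD R n) :
  ip a (cd_one R n) = 0 -> ip (cd_mul a c) (cd_one R n) = - ip a c.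
Proof. by move=> a1; rewrite ip_mull cd_mul1r cd_conj_imag // ipNr ipC. Qed.

(** * The top unit and doubly pure elements *)

Lemma cd_conj_i n : cd_conj (cd_i R n) = - cd_i R n.
Proof. by apply: pair_ext; rewrite /= ?cd_conj0 ?oppr0. Qed.

Lemma cd_mul_il n (a b : CD R n) :
  cd_mul (cd_i R n) ((a, b) : CD R n.+1) = (- cd_conj b, cd_conj a).
Proof. by rewrite /= !cd_mulE !cd_mul1r !cd_mul1l sub0r add0r. Qed.

Lemma cd_mul_ir n (a b : CD R n) :
  cd_mul ((a, b) : CD R n.+1) (cd_i R n) = (- b, a).
Proof. by rewrite /= cd_conj1 cd_conj0 !cd_mulE !cd_mul1l sub0r addr0. Qed.

Lemma cd_mul_ii n (x : CD R n.+1) : cd_mul (cd_i R n) (cd_mul (cd_i R n) x) = - x.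
Proof.
by case: x => a b; rewrite (cd_mul_il a b) cd_mul_il cd_conjN !cd_conjK.
Qed.

Lemma ip_i1 n : ip (cd_i R n) (cd_one R n.+1) = 0.
Proof. by rewrite /= ip0l ip0r addr0. Qed.

Lemma ip_ii n : ip (cd_i R n) (cd_i R n) = 1.
Proof. by rewrite /= ip0l ip11 add0r. Qed.

Lemma ip_mul_i n (x y : CD R n.+1) :
  ip (cd_mul (cd_i R n) x) y = - ip x (cd_mul (cd_i R n) y).
Proof. by rewrite ip_mull cd_conj_i !cd_mulE ipNr. Qed.

Lemma ip_il_self n (x : CD R n.+1) : ip (cd_mul (cd_i R n) x) x = 0.
Proof. by have := ip_mul_i x x; rewrite [in RHS]ipC => H; lra. Qed.

Lemma ip_il_il n (x y : CD R n.+1) :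
  ip (cd_mul (cd_i R n) x) (cd_mul (cd_i R n) y) = ip x y.
Proof. by rewrite ip_mul_i cd_mul_ii ipNr opprK. Qed.

Lemma cd_mul_irE n (x : CD R n.+1) :
  cd_mul x (cd_i R n) =
  (2 * ip x (cd_one R n.+1)) *: cd_i R n - (2 * ip x (cd_i R n)) *: cd_one R n.+1
  - cd_mul (cd_i R n) x.
Proof.
case: x => a b; rewrite cd_mul_il cd_mul_ir.
apply: pair_ext; rewrite /= !ip0r ?addr0 ?add0r ?scaler0 ?sub0r ?oppr0 ?addr0 cd_conjE.
  by rewrite opprK addrA addNr add0r.
by rewrite opprB addrC subrK.
Qed.

Definition doubly_pure n (x : CD R n.+1) :=
  ip x (cd_one R n.+1) = 0 /\ ip x (cd_i R n) = 0.

(** This anticommutation makes multiplication by a conjugate-linear for the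
complex structure y |-> i_(n+1) y; the whole proof rests on it. *)
Lemma cd_mul_pure_i n (a y : CD R n.+1) : doubly_pure a ->
  cd_mul a (cd_mul (cd_i R n) y) = - cd_mul (cd_i R n) (cd_mul a y).
Proof.
case: a y => a b [c d] [a0 b0].
have {}a0 : cd_conj a = - a by apply: cd_conj_imag; rewrite /= ip0r addr0 in a0.
have {}b0 : cd_conj b = - b by apply: cd_conj_imag; rewrite /= ip0r add0r in b0.
rewrite (cd_mul_il c d).
have -> : cd_mul ((a, b) : CD R n.+1) ((- cd_conj d, cd_conj c) : CD R n.+1) =
  (- cd_mul a (cd_conj d) - cd_mul c b, cd_mul (cd_conj c) a - cd_mul b d).
  by apply: pair_ext; rewrite /= ?cd_conjN !cd_conjK !cd_mulE.
have -> : cd_mul ((a, b) : CD R n.+1) ((c, d) : CD R n.+1) =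
  (cd_mul a c - cd_mul (cd_conj d) b, cd_mul d a + cd_mul b (cd_conj c)) by [].
rewrite cd_mul_il !cd_conjD !cd_conjN !cd_conjM !cd_conjK a0 b0 !cd_mulE.
by apply: pair_ext; rewrite /= !opprD !opprK // addrC.
Qed.

(** With i = i_(n+1), the component of x along 1 is visible in <x y, y> and the
one along i in <x y, i y>: the rest of x contributes nothing to the first
product because it acts by a skew-adjoint operator, and nothing to the second
because this operator moreover anticommutes with multiplication by i. *)
Lemma zero_divisor_pure n (x y : CD R n.+1) : y != 0 -> cd_mul x y = 0 -> doubly_pure x.
Proof.
move=> y0 xy0; have yy : ip y y != 0 by rewrite ip_eq0.
have x1 : ip x (cd_one R n.+1) = 0.
  have : ip (cd_mul x y) y = 0 by rewrite xy0 ip0l.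
  by rewrite ip_mulr (cd_mul_conj y).1 ipZr => /eqP; rewrite mulf_eq0 (negbTE yy) => /eqP.
split=> //; pose s := ip x (cd_i R n).
pose x0 := x - s *: cd_i R n.
have px0 : doubly_pure x0.
  by split; rewrite ipDl ipNl ipZl ?ip_i1 ?ip_ii ?x1 ?mulr0 ?mulr1 subrr.
have x0c := cd_conj_imag px0.1.
have Ex0 : cd_mul x0 y = - (s *: cd_mul (cd_i R n) y) by rewrite !cd_mulE xy0 add0r.
have : ip (cd_mul x0 y) (cd_mul (cd_i R n) y) = 0.
  clearbody x0; set p := ip _ _; suff : p = - p by move=> H; lra.
  by rewrite {1}/p ip_mull x0c !cd_mulE cd_mul_pure_i // opprK (ipC y) ip_mul_i.
rewrite Ex0 ipNl ipZl ip_mul_i cd_mul_ii ipNr opprK => /eqP.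
by rewrite oppr_eq0 mulf_eq0 (negbTE yy) orbF => /eqP.
Qed.

End Algebra.

(** * Dimension counts *)

Section Dimension.
Variables (F : fieldType) (V W : vectType F).

(** Rank-nullity as an inequality, keeping the kernel U0 for further maps: the
annihilators below are bounded by peeling off one linear map after another. *)
Lemma dim_le_image_kernel (f : V -> W) (U : {vspace V}) (W0 : {vspace W}) :
  linear f -> (forall u, u \in U -> f u \in W0) ->
  exists U0 : {vspace V}, (forall u, u \in U0 -> u \in U /\ f u = 0) /\
    (\dim U <= \dim W0 + \dim U0)%N.
Proof.
move=> lin_f fU.
pose g : {linear V -> W} := HB.pack f (GRing.isLinear.Build F V W *:%R f lin_f).
exists (U :&: lker (linfun g))%VS; split.
  by move=> u /memv_capP[uU]; rewrite memv_ker lfunE => /eqP.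
rewrite -(limg_ker_dim (linfun g) U) addnC leq_add2r dimvS //.
by apply/subvP => w /memv_imgP[u uU ->]; rewrite lfunE; exact: fU.
Qed.

Lemma dim_injection (f : V -> W) (U : {vspace V}) (W0 : {vspace W}) :
  linear f -> (forall u, u \in U -> f u \in W0) ->
  (forall u, u \in U -> f u = 0 -> u = 0) -> (\dim U <= \dim W0)%N.
Proof.
move=> lin_f fU f0; have [U0 [U0P]] := dim_le_image_kernel lin_f fU.
suff -> : U0 = 0%VS by rewrite dimv0 addn0.
by apply/eqP; rewrite -subv0; apply/subvP => u /U0P[uU /(f0 _ uU) ->]; exact: mem0v.
Qed.

End Dimension.

Section Perp.
Variable R : realType.

Lemma ip_is_linear n (x : CD R n) : linear (ip x : CD R n -> R^o).
Proof. by move=> k y z; rewrite ipDr ipZr. Qed.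

HB.instance Definition _ n (x : CD R n) :=
  GRing.isLinear.Build R (CD R n) R^o *:%R (ip x : CD R n -> R^o) (ip_is_linear x).

Fixpoint perp n (s : seq (CD R n)) : {vspace CD R n} :=
  if s is e :: s' then (lker (linfun (ip e : CD R n -> R^o)) :&: perp s')%VS
  else fullv.

Lemma mem_perp n (s : seq (CD R n)) w :
  (w \in perp s) = all (fun e => ip e w == 0) s.
Proof.
elim: s => [|e s IH] /=; first exact: memvf.
by rewrite memv_cap IH memv_ker lfunE.
Qed.

Lemma dim_CD n : \dim {: CD R n} = (2 ^ n)%N.
Proof.
rewrite dimvf; elim: n => [|n IH] //.
by rewrite expnS mul2n -addnn -{1 2}IH.
Qed.

Lemma dim_perp n (s : seq (CD R n)) :
  pairwise (fun x y => ip x y == 0) s -> all (fun x => x != 0) s ->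
  (\dim (perp s) + size s <= 2 ^ n)%N.
Proof.
elim: s => [|e s IH]; first by rewrite addn0 dim_CD.
rewrite pairwise_cons => /andP[es /IH{}IH] /= /andP[e0 /IH{}IH].
rewrite addnS; apply: leq_trans IH; rewrite -addSn leq_add2r.
rewrite ltn_neqAle dimvS ?capvSr // andbT.
(* e lies in the larger space because it is orthogonal to s, but not in the
   smaller one because it is not orthogonal to itself. *)
rewrite (dimv_leqif_sup (capvSr _ _)).2; apply/negP => /subvP /(_ e).
have -> : e \in perp s.
  by rewrite mem_perp; apply: sub_all es => x; rewrite ipC.
by move=> /(_ isT); rewrite memv_cap memv_ker lfunE ip_eq0 (negbTE e0).
Qed.

(** The copy of the complex numbers spanned by 1 and i_(n+1). *)
Definition cd_C n : {vspace CD R n.+1} := (<[cd_one R n.+1]> + <[cd_i R n]>)%VS.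

Lemma dim_cd_C n : (\dim (cd_C n) <= 2)%N.
Proof.
apply: leq_trans (dimv_add_leqif _ _).1 _.
by rewrite !dim_vline; case: (_ != _); case: (_ != _).
Qed.

Lemma ortho_pure_mem_C n (z : CD R n.+1) :
  (forall w, doubly_pure w -> ip z w = 0) -> z \in cd_C n.
Proof.
move=> zP; set o := cd_one R n.+1; set j := cd_i R n.
pose w := z - (ip z o *: o + ip z j *: j).
have [w1 wj] : doubly_pure w.
  by split; rewrite ipDl ipNl ipDl !ipZl ?(ipC o j) ?ip_i1 ?ip_ii ?ip11; ring.
have /eqP : ip w w = 0.
  by rewrite {2}/w ipDr ipNr ipDr !ipZr w1 wj !mulr0 addr0 subr0 ipC zP.
rewrite ip_eq0 subr_eq0 => /eqP ->.
by rewrite memv_add // memvZ // memv_line.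
Qed.

End Perp.

(** * The equations of an annihilator *)

Section Core.
Variable R : realType.
Local Notation o := (cd_one R _).
Local Notation j := (cd_i R _).

Lemma cd_mul_i_i n : cd_mul (cd_i R n) (cd_i R n) = - o.
Proof. by rewrite -{2}(cd_mul1r j) cd_mul_ii. Qed.

Lemma pure_mul_il n (a : CD R n.+1) : doubly_pure a -> doubly_pure (cd_mul j a).
Proof.
case=> a1 ai; split; rewrite ip_mul_i.
  by rewrite cd_mul1r ai oppr0.
by rewrite cd_mul_i_i ipNr a1 !oppr0.
Qed.

Lemma pureD n (a b : CD R n.+1) : doubly_pure a -> doubly_pure b -> doubly_pure (a + b).
Proof. by move=> [a1 ai] [b1 bi]; split; rewrite ipDl ?a1 ?ai ?b1 ?bi addr0. Qed.

Lemma pureZ n k (a : CD R n.+1) : doubly_pure a -> doubly_pure (k *: a).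
Proof. by move=> [a1 ai]; split; rewrite ipZl ?a1 ?ai mulr0. Qed.

Lemma pureN n (a : CD R n.+1) : doubly_pure a -> doubly_pure (- a).
Proof. by move=> [a1 ai]; split; rewrite ipNl ?a1 ?ai oppr0. Qed.

Lemma pure_mul_ir n (a : CD R n.+1) : doubly_pure a -> cd_mul a j = - cd_mul j a.
Proof. by case=> a1 ai; rewrite cd_mul_irE a1 ai !mulr0 !scale0r subr0 add0r. Qed.

Lemma imag_decomp n (x : CD R n.+1) : ip x o = 0 ->
  exists x0, doubly_pure x0 /\ x = x0 + ip x j *: j.
Proof.
move=> x1; exists (x - ip x j *: j); split; last by rewrite subrK.
by split; rewrite ipDl ipNl ipZl ?ip_i1 ?ip_ii ?x1 ?mulr0 ?mulr1 subrr.
Qed.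

(** Conjugating a (j y) = - j (a y) moves the j of a left factor out; the
result is - j (a y) up to C, and the correction is the commutator of a y
with j. *)
Lemma mul_il_pure n (a y : CD R n.+1) : doubly_pure a -> doubly_pure y ->
  cd_mul (cd_mul j a) y = (2 * ip (cd_mul a y) o) *: j - (2 * ip (cd_mul a y) j) *: o
    - cd_mul j (cd_mul a y).
Proof.
move=> pa py; rewrite -cd_mul_irE.
rewrite -[LHS]cd_conjK cd_conjM (cd_conj_imag py.1) (cd_conj_imag (pure_mul_il pa).1).
rewrite !cd_mulE opprK cd_mul_pure_i // cd_conjN cd_conjM cd_conj_i.
by rewrite cd_conjM_im ?(pa.1) ?(py.1) // !cd_mulE opprK.
Qed.

(** Up to C, doubly pure elements anticommute and j can be pulled out of every
product at the price of a sign, so the product is congruent to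
(a c + d b) + j (b c - d a).  Testing against doubly pure vectors w is how C is
discarded. *)
Lemma mul_split_mem_C n (a b c d : CD R n.+1) :
  doubly_pure a -> doubly_pure b -> doubly_pure c -> doubly_pure d ->
  cd_mul a c + cd_mul d b = 0 -> cd_mul d a = cd_mul b c ->
  cd_mul (a - cd_mul j b) (c - cd_mul j d) \in cd_C R n.
Proof.
move=> pa pb pc pd E1 E2; apply: ortho_pure_mem_C => w pw.
have F1 : ip (cd_mul a c) w = - ip (cd_mul d b) w.
  by have := ip0l w; rewrite -E1 ipDl => H; lra.
have F2 : ip (cd_mul j (cd_mul d a)) w = ip (cd_mul j (cd_mul b c)) w by rewrite E2.
have [w1 wj] : ip o w = 0 /\ ip j w = 0 by case: pw; rewrite !(ipC w).
rewrite !cd_mulE (cd_mul_pure_i _ pa) (cd_mul_pure_i _ (pure_mul_il pb)).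
rewrite !(mul_il_pure pb) // !cd_mulE !cd_mul_i_i cd_mul_ii cd_mul1r.
rewrite (cd_anticomm pd.1 pa.1) (cd_anticomm pd.1 pb.1) !cd_mulE !cd_mul1r !ipE.
rewrite w1 wj F1 F2; ring.
Qed.

(** Adding j times the second equation to the first kills the products of
doubly pure parts outside C and leaves
<a c0, 1> + <a c0, j> j = <d, j> a + <c, j> (j a), where c0 is the doubly pure
part of c.  The left side is in C and the right side is orthogonal to it, so
all four coefficients vanish. *)
Lemma Ann_double_eqs n (a c d : CD R n.+1) (ja := cd_mul j a) : a != 0 ->
  doubly_pure a -> ip c o = 0 -> ip d o = 0 ->
  cd_mul a c + cd_mul d ja = 0 -> cd_mul d a = cd_mul ja c ->
  [/\ ip a c = 0, ip ja c = 0 & cd_mul a (c - cd_mul j d) = 0].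
Proof.
move=> a0 pa c1 d1 E1 E2.
have aa : ip a a != 0 by rewrite ip_eq0.
pose g := ip c j; pose t := ip d j.
have [c0 [pc]] := imag_decomp c1; rewrite -/g => Ec.
have [d0 [pd]] := imag_decomp d1; rewrite -/t => Ed.
have pja : doubly_pure ja by exact: pure_mul_il.
set p := ip (cd_mul a c0) o; set q := ip (cd_mul a c0) j.
have V : p *: o + q *: j = t *: a + g *: ja.
  apply: cd_ext => w.
  have := ip0l w; rewrite -E1.
  have : ip (cd_mul j (cd_mul d a)) w = ip (cd_mul j (cd_mul ja c)) w by rewrite E2.
  rewrite /ja Ec Ed !cd_mulE (pure_mul_ir pa) (pure_mul_ir (pure_mul_il pa)).
  rewrite (cd_mul_pure_i _ pd) (mul_il_pure pa pc) -/p -/q !cd_mulE.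
  rewrite !cd_mul_i_i !cd_mul_ii cd_mul1r !cd_mulE !ipE => H1 H2; lra.
have W w : p * ip o w + q * ip j w = t * ip a w + g * ip ja w.
  by have := congr1 (fun z => ip z w) V; rewrite !ipE.
have iaja : ip ja a = 0 by exact: ip_il_self.
have [wa1 waj] := pa; have [wja1 wjaj] := pja.
have p0 : p = 0 by have := W o; rewrite wa1 wja1 ip_i1 ip11 => H; lra.
have q0 : q = 0 by have := W j; rewrite waj wjaj (ipC o) ip_i1 ip_ii => H; lra.
have t0 : t = 0.
  have := W a; rewrite p0 q0 iaja => H; apply/eqP.
  have /eqP : t * ip a a = 0 by lra.
  by rewrite mulf_eq0 (negbTE aa) orbF.
have g0 : g = 0.
  have := W ja; rewrite p0 q0 t0 => H; apply/eqP.
  have /eqP : g * ip ja ja = 0 by lra.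
  by rewrite ip_il_il mulf_eq0 (negbTE aa) orbF.
have Ec' : c = c0 by rewrite Ec g0 scale0r addr0.
have Ed' : d = d0 by rewrite Ed t0 scale0r addr0.
have ac0 : ip a c = 0 by have := p0; rewrite /p ip_mul1 // Ec' => H; lra.
have jac0 : ip ja c = 0.
  rewrite Ec' ipC -q0 /q ip_mull (cd_conj_imag wa1) cd_mulNl (pure_mul_ir pa).
  by rewrite opprK.
split=> //.
have da0 : ip d a = 0.
  have := congr1 (fun z => ip z o) E2.
  rewrite (ip_mul1 _ d1) (ip_mul1 _ wja1) jac0 => H; lra.
move: E1; rewrite Ed' /ja (cd_mul_pure_i _ pd) => E1.
rewrite cd_mulDr cd_mulNr (cd_mul_pure_i _ pa) (cd_anticomm pd.1 pa.1) -Ed' da0.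
by rewrite mulr0 oppr0 scale0r sub0r cd_mulNr !opprK Ed'.
Qed.

(** The last hypothesis says that c + j d lies in C, that is, c and j d have
opposite doubly pure parts: d = j y + <d, j> j, where y is the doubly pure part
of c.  Adding j times the second equation to the first gives, with complex
scalars acting through j,  2 (be + al j) y = (t + g j) u,  where al, be, g, t
are the components of a, b, c, d along j.  The real parts of the two equations
say that <y, u> = - S and <y, j u> = Q, where S = be t + al g and
Q = al t - be g.  Taking inner products of the first identity with u and j u
then yields 2 (al^2 + be^2) S = - <u, u> S, and the same for Q, so S = Q = 0 by
the signs; since (al, be) is not zero, g = t = 0 and y = 0. *)
Lemma Ann_i_component_eq0 n (a b c d : CD R n.+1) :
  ip a o = 0 -> ip b o = 0 -> ip c o = 0 -> ip d o = 0 ->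
  ip a j != 0 \/ ip b j != 0 ->
  cd_mul a c + cd_mul d b = 0 -> cd_mul d a = cd_mul b c ->
  c + cd_mul j d - ip c j *: j + ip d j *: o = 0 -> c = 0 /\ d = 0.
Proof.
move=> a1 b1 c1 d1 lam E1 E2 E3.
have [a0 [pa Ea]] := imag_decomp a1; have [b0 [pb Eb]] := imag_decomp b1.
have [y [py Ec]] := imag_decomp c1.
set al := ip a j in lam Ea *; set be := ip b j in lam Eb *.
set g := ip c j in Ec E3 *; set t := ip d j in E3 *.
have Ed : d = cd_mul j y + t *: j.
  have H : cd_mul j (c + cd_mul j d - g *: j + t *: o) = 0 by rewrite E3 cd_mul0r.
  move: H; rewrite Ec !cd_mulE !cd_mul_ii !cd_mul_i_i cd_mul1r => H.
  apply: cd_ext => w; have := congr1 (fun z => ip z w) H; rewrite !ipE => H1; lra.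
pose u := a0 - cd_mul j b0; pose ju := cd_mul j u.
have pu : doubly_pure u by apply/pureD/pureN/pure_mul_il.
have pju : doubly_pure ju by apply: pure_mul_il.
pose jy := cd_mul j y; have pjy : doubly_pure jy by apply: pure_mul_il.
pose v := (2 * be) *: y + (2 * al) *: jy - t *: u - g *: ju.
have pv : doubly_pure v.
  apply/pureD/pureN/pureZ => //; apply/pureD/pureN/pureZ => //.
  by apply/pureD; apply/pureZ.
have v0 : v = 0.
  (* v is doubly pure, and orthogonal to all doubly pure vectors. *)
  apply/eqP; rewrite -ip_eq0; apply/eqP.
  suff H w : doubly_pure w -> ip v w = 0 by exact: H.
  move=> pw; have [w1 wj] : ip o w = 0 /\ ip j w = 0 by case: pw; rewrite !(ipC w).
  have := ip0l w; rewrite -E1.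
  have : ip (cd_mul j (cd_mul d a)) w = ip (cd_mul j (cd_mul b c)) w by rewrite E2.
  rewrite /v /ju /u /jy Ea Eb Ec Ed !cd_mulE.
  rewrite (pure_mul_ir pa) (pure_mul_ir pb) (pure_mul_ir pjy).
  rewrite !(mul_il_pure py) // !cd_mulE !cd_mul_i_i !cd_mul_ii !cd_mul1r.
  rewrite (cd_anticomm pa.1 py.1) (cd_anticomm pb.1 py.1) !cd_mulE !cd_mul1r.
  rewrite !ipE w1 wj => H1 H2; lra.
have iuju : ip ju u = 0 by exact: ip_il_self.
have jyy : ip jy y = 0 by exact: ip_il_self.
have jyjy : ip jy jy = ip y y by exact: ip_il_il.
have jyu : ip jy u = - ip y ju by exact: ip_mul_i.
have jyju : ip jy ju = ip y u by exact: ip_il_il.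
have juju : ip ju ju = ip u u by exact: ip_il_il.
have Yu : ip y u = - (be * t + al * g).
  have := ip0l (cd_one R n.+1); rewrite -E1 ipDl (ip_mul1 _ a1) (ip_mul1 _ d1).
  have [_ ya] := pa; have [_ yb] := pb; have [_ yy] := py; have [_ yjy] := pjy.
  rewrite Ea Eb Ec Ed /u -/jy (ipC y) !ipE !ip_ii !(ipC (cd_i R n)) ?ya ?yb ?yy ?yjy.
  rewrite (ip_mul_i b0 y) (ipC b0) => H; lra.
have Yju : ip y ju = al * t - be * g.
  have := congr1 (fun z => ip z o) E2; rewrite (ip_mul1 _ b1) (ip_mul1 _ d1).
  have [_ ya] := pa; have [_ yb] := pb; have [_ yy] := py; have [_ yjy] := pjy.
  rewrite Ea Eb Ec Ed /ju /u -/jy !cd_mulE cd_mul_ii opprK (ipC y) !ipE !ip_ii.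
  rewrite !(ipC (cd_i R n)) ?ya ?yb ?yy ?yjy.
  rewrite (ip_mul_i a0 y) (ipC a0) => H; lra.
have vE : (2 * be) *: y + (2 * al) *: jy - t *: u - g *: ju = 0 by exact: v0.
clear pv v0 v; clearbody ju; clearbody u; clearbody jy.
have Hu : 2 * be * ip y u - 2 * al * ip y ju = t * ip u u.
  have := congr1 (fun z => ip z u) vE; rewrite !ipE jyu iuju => H; lra.
have Hju : 2 * be * ip y ju + 2 * al * ip y u = g * ip u u.
  have := congr1 (fun z => ip z ju) vE; rewrite !ipE jyju juju (ipC u) iuju => H; lra.
pose S := be * t + al * g; pose Q := al * t - be * g.
have L0 : 0 < al ^+ 2 + be ^+ 2.
  by case: lam => h; [rewrite ltr_pwDl ?sqr_ge0 | rewrite ltr_pwDr ?sqr_ge0];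
    rewrite // lt0r sqr_ge0 sqrf_eq0 h.
have U0 : 2 * (al ^+ 2 + be ^+ 2) + ip u u != 0.
  by rewrite gt_eqF // ltr_pwDl ?ip_ge0 // mulr_gt0.
have S0 : S = 0.
  apply/eqP; have /eqP : (2 * (al ^+ 2 + be ^+ 2) + ip u u) * S =
    be * (t * ip u u) + al * (g * ip u u) + 2 * (al ^+ 2 + be ^+ 2) * S.
    by rewrite /S; ring.
  rewrite -Hu -Hju Yu Yju -/S -/Q.
  have -> : be * (2 * be * - S - 2 * al * Q) + al * (2 * be * Q + 2 * al * - S) +
      2 * (al ^+ 2 + be ^+ 2) * S = 0 by ring.
  by rewrite mulf_eq0 (negbTE U0).
have Q0 : Q = 0.
  apply/eqP; have /eqP : (2 * (al ^+ 2 + be ^+ 2) + ip u u) * Q =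
    al * (t * ip u u) - be * (g * ip u u) + 2 * (al ^+ 2 + be ^+ 2) * Q.
    by rewrite /Q; ring.
  rewrite -Hu -Hju Yu Yju -/S -/Q.
  have -> : al * (2 * be * - S - 2 * al * Q) - be * (2 * be * Q + 2 * al * - S) +
      2 * (al ^+ 2 + be ^+ 2) * Q = 0 by ring.
  by rewrite mulf_eq0 (negbTE U0).
have t0 : t = 0.
  apply/eqP; have /eqP : (al ^+ 2 + be ^+ 2) * t = be * S + al * Q by rewrite /S /Q; ring.
  by rewrite S0 Q0 !mulr0 addr0 mulf_eq0 gt_eqF.
have g0 : g = 0.
  apply/eqP; have /eqP : (al ^+ 2 + be ^+ 2) * g = al * S - be * Q by rewrite /S /Q; ring.
  by rewrite S0 Q0 !mulr0 subr0 mulf_eq0 gt_eqF.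
have y0 : y = 0.
  apply/eqP; rewrite -ip_eq0; case: lam => h.
    have /eqP : al * ip y y = 0.
      have := congr1 (fun z => ip z jy) vE.
      rewrite t0 g0 !ipE jyjy (ipC y) jyy => H; lra.
    by rewrite mulf_eq0 (negbTE h).
  have /eqP : be * ip y y = 0.
    have := congr1 (fun z => ip z y) vE.
    rewrite t0 g0 !ipE jyy => H; lra.
  by rewrite mulf_eq0 (negbTE h).
by rewrite Ec Ed y0 t0 g0 cd_mul0r !scale0r addr0.
Qed.
End Core.

(** * Bounds for the dimension of an annihilator *)

Section Count.
Variable R : realType.
Local Notation o := (cd_one R _).
Local Notation j := (cd_i R _).

Lemma ip_pair1 n (a b : CD R n) : ip ((a, b) : CD R n.+1) o = ip a o.
Proof. by rewrite /= ip0r addr0. Qed.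

Lemma ip_pairi n (a b : CD R n) : ip ((a, b) : CD R n.+1) j = ip b o.
Proof. by rewrite /= ip0r add0r. Qed.

Lemma cd_mul_pair n (a b c d : CD R n) :
  cd_mul ((a, b) : CD R n.+1) ((c, d) : CD R n.+1) =
  (cd_mul a c - cd_mul (cd_conj d) b, cd_mul d a + cd_mul b (cd_conj c)).
Proof. by []. Qed.

(* Projections of explicit pairs are to be simplified below, without unfolding
   the algebra one level down. *)
Local Arguments ip : simpl never.
Local Arguments cd_mul : simpl never.
Local Arguments cd_conj : simpl never.
Local Arguments cd_one : simpl never.

(** For imaginary x, conjugating x k = 0 shows that the conjugate of k is a left
zero-divisor too. *)
Lemma Ann_pure n (x k : CD R n.+1) : x != 0 -> k \in Ann x -> doubly_pure k.
Proof.
move=> x0 /mem_Ann xk; have [->|k0] := eqVneq k 0; first by rewrite /doubly_pure !ip0l.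
have [x1 _] := zero_divisor_pure k0 xk.
have kx : cd_mul (cd_conj k) x = 0.
  have /eqP := congr1 (@cd_conj R _) xk.
  by rewrite cd_conjM (cd_conj_imag x1) cd_mulNr cd_conj0 oppr_eq0 => /eqP.
have [k1 ki] := zero_divisor_pure x0 kx.
split; first by rewrite -ip_conj1.
by apply/eqP; rewrite -ip_conj cd_conj_i ipNr ki oppr0.
Qed.

Lemma Ann_pair_eqs n (a b : CD R n) (k : CD R n.+1) :
  ((a, b) : CD R n.+1) != 0 -> ip a o = 0 -> ip b o = 0 -> k \in Ann ((a, b) : CD R n.+1) ->
  let c : CD R n := k.1 in let d : CD R n := k.2 in
  [/\ ip c o = 0, ip d o = 0, cd_mul a c + cd_mul d b = 0 & cd_mul d a = cd_mul b c].
Proof.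
move=> x0 a1 b1 kA; have [k1 ki] := Ann_pure x0 kA.
case: k kA k1 ki => c d kA; rewrite ip_pair1 ip_pairi => c1 d1.
move/mem_Ann: kA; rewrite cd_mul_pair => -[] /=.
rewrite (cd_conj_imag c1) (cd_conj_imag d1) cd_mulNl cd_mulNr opprK => E1 /eqP.
by rewrite subr_eq0 => /eqP.
Qed.

(** The map f below is k |-> c + j d with its components in C removed; on
imaginary c and d those are <c, j> j and - <d, j>. *)
Lemma dim_Ann_i_component n (a b : CD R n.+1) : ip a o = 0 -> ip b o = 0 ->
  ip a j != 0 \/ ip b j != 0 ->
  (\dim (Ann ((a, b) : CD R n.+2)) + 2 <= 2 ^ n.+1)%N.
Proof.
move=> a1 b1 lam.
have x0 : ((a, b) : CD R n.+2) != 0.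
  by apply/eqP => -[a0 b0]; move: lam; rewrite a0 b0 !ip0l eqxx => -[].
pose f (k : CD R n.+2) : CD R n.+1 :=
  let c : CD R n.+1 := k.1 in let d : CD R n.+1 := k.2 in
  c + cd_mul j d - ip c j *: j + ip d j *: o.
have lin_f : linear f.
  move=> s [c d] [c' d']; apply: cd_ext => w.
  by rewrite /f /= !cd_mulE !ipE; ring.
have o0 : cd_one R n.+1 != 0 by rewrite -ip_eq0 ip11 oner_eq0.
have j0 : cd_i R n != 0 by rewrite -ip_eq0 ip_ii oner_eq0.
have := @dim_perp R n.+1 [:: cd_one R n.+1; cd_i R n].
rewrite /= (ipC (cd_one R n.+1)) ip_i1 eqxx o0 j0 => /(_ isT isT).
apply: leq_trans; rewrite leq_add2r.
apply: (dim_injection lin_f) => k kA; have [c1 d1 E1 E2] := Ann_pair_eqs x0 a1 b1 kA.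
  rewrite (mem_perp [:: cd_one R n.+1; cd_i R n]) /= /f.
  rewrite (ipC (cd_one R n.+1)) (ipC (cd_i R n)) !ipE ip_i1 ip11 ip_ii c1.
  rewrite (ipC (cd_one R n.+1)) ip_i1 !ip_mul_i cd_mul1r cd_mul_i_i ipNr d1.
  by apply/and3P; split=> //; apply/eqP; ring.
by move=> /(Ann_i_component_eq0 a1 b1 c1 d1 lam E1 E2) [] *; exact: pair_ext.
Qed.

Lemma dim_preim_C n (u : CD R n.+1) :
  (\dim (linfun (cd_mul u) @^-1: cd_C R n)%VS <= \dim (Ann u) + 2)%N.
Proof.
have lin_u : linear (cd_mul u) by move=> k x y; exact: linearP.
pose U := (linfun (cd_mul u) @^-1: cd_C R n)%VS.
have [|U0 [U0P le]] := dim_le_image_kernel (U := U) (W0 := cd_C R n) lin_u.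
  by move=> y; rewrite -memv_preim lfunE.
apply: leq_trans le _; rewrite addnC leq_add ?dim_cd_C // dimvS //.
by apply/subvP => y /U0P[_ uy]; apply/mem_Ann.
Qed.

(** The summand 6 is 2 for the components of c and d along j, plus 2 for each of
the two preimages of C. *)
Lemma dim_Ann_pure n (a b : CD R n.+1) (u := a - cd_mul j b) (v := a + cd_mul j b) :
  doubly_pure a -> doubly_pure b -> ((a, b) : CD R n.+2) != 0 ->
  (\dim (Ann ((a, b) : CD R n.+2)) <= \dim (Ann u) + \dim (Ann v) + 6)%N.
Proof.
move=> pa pb x0.
pose f1 (k : CD R n.+2) : (R^o * R^o)%type :=
  (ip (k.1 : CD R n.+1) j, ip (k.2 : CD R n.+1) j).
pose f2 (k : CD R n.+2) : CD R n.+1 := (k.1 : CD R n.+1) - cd_mul j k.2.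
pose f3 (k : CD R n.+2) : CD R n.+1 := (k.1 : CD R n.+1) + cd_mul j k.2.
have lin1 : linear f1 by move=> s [c d] [c' d']; apply: pair_ext; rewrite /= ipDl ipZl.
have lin2 : linear f2.
  by move=> s [c d] [c' d']; apply: cd_ext => w; rewrite /f2 /= !cd_mulE !ipE; ring.
have lin3 : linear f3.
  by move=> s [c d] [c' d']; apply: cd_ext => w; rewrite /f3 /= !cd_mulE !ipE; ring.
pose W u := (linfun (cd_mul u) @^-1: cd_C R n)%VS.
pose A := Ann ((a, b) : CD R n.+2).
have [|U1 [U1P le1]] := dim_le_image_kernel (U := A) (W0 := fullv) lin1.
  by move=> k _; exact: memvf.
have eqs k : k \in U1 -> let c : CD R n.+1 := k.1 in let d : CD R n.+1 := k.2 in
    [/\ doubly_pure c, doubly_pure d, cd_mul a c + cd_mul d b = 0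
      & cd_mul d a = cd_mul b c].
  by move=> /U1P[kA [ci di]]; have [c1 d1 E1 E2] := Ann_pair_eqs x0 pa.1 pb.1 kA.
have [|U2 [U2P le2]] := dim_le_image_kernel (U := U1) (W0 := W u) lin2.
  move=> k /eqs[pc pd E1 E2]; rewrite -memv_preim lfunE; exact: mul_split_mem_C.
have le3 : (\dim U2 <= \dim (W v))%N.
  apply: (dim_injection lin3) => k /U2P[/eqs[pc pd E1 E2] f2k].
    rewrite -memv_preim lfunE /= /v /f3.
    (* The equations are invariant under (b, d) |-> (- b, - d), which exchanges
       u with v and c - j d with c + j d. *)
    have N (z : CD R n.+1) : cd_mul j z = - cd_mul j (- z) by rewrite cd_mulNr opprK.
    rewrite (N b) (N k.2).
    apply: mul_split_mem_C => //; try exact: pureN.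
      by rewrite cd_mulNl cd_mulNr opprK.
    by rewrite !cd_mulNl E2.
  move=> f3k; have c0 : (k.1 : CD R n.+1) = 0.
    apply: cd_ext => w; have := congr1 (fun z => ip z w) f2k.
    by have := congr1 (fun z => ip z w) f3k; rewrite /f2 /f3 !ipE => H1 H2; lra.
  have d0 : (k.2 : CD R n.+1) = 0.
    move: f3k; rewrite /f3 c0 add0r => /(congr1 (cd_mul j)); rewrite cd_mul_ii cd_mul0r.
    by move/eqP; rewrite oppr_eq0 => /eqP.
  exact: pair_ext.
have d2 : \dim {: (R^o * R^o)%type} = 2%N by rewrite dimvf.
have := dim_preim_C u; have := dim_preim_C v.
by rewrite d2 in le1; rewrite -/A -!/(W _); lia.
Qed.

(** The map k |-> c - j d sends the annihilator to Ann a; on its kernel, k is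
determined by c, which is orthogonal to 1, j, a and j a. *)
Lemma dim_Ann_double n (a : CD R n.+1) : doubly_pure a -> a != 0 ->
  (\dim (Ann ((a, cd_mul j a) : CD R n.+2)) + 4 <= \dim (Ann a) + 2 ^ n.+1)%N.
Proof.
move=> pa a0; set ja := cd_mul j a.
have pja : doubly_pure ja by exact: pure_mul_il.
have x0 : ((a, ja) : CD R n.+2) != 0 by apply: contra a0 => /eqP[->].
pose f1 (k : CD R n.+2) : CD R n.+1 := (k.1 : CD R n.+1) - cd_mul j k.2.
pose f2 (k : CD R n.+2) : CD R n.+1 := k.1.
have lin1 : linear f1.
  by move=> s [c d] [c' d']; apply: cd_ext => w; rewrite /f1 /= !cd_mulE !ipE; ring.
have lin2 : linear f2 by [].
pose s := [:: cd_one R n.+1; cd_i R n; a; ja].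
have ja0 : ja != 0 by rewrite -ip_eq0 ip_il_il ip_eq0.
have aja : ip a ja = 0 by rewrite ipC; exact: ip_il_self.
have o0 : cd_one R n.+1 != 0 by rewrite -ip_eq0 ip11 oner_eq0.
have j0 : cd_i R n != 0 by rewrite -ip_eq0 ip_ii oner_eq0.
have le3 : (\dim (perp s) + 4 <= 2 ^ n.+1)%N.
  apply: dim_perp; rewrite /= ?o0 ?j0 ?a0 ?ja0 //.
  rewrite !(ipC (cd_one R n.+1)) (ipC (cd_i R n) a) (ipC (cd_i R n) ja) aja.
  rewrite ip_i1 (pa.1) (pa.2) (pja.1) (pja.2) !eqxx //.
have eqs k : k \in Ann ((a, ja) : CD R n.+2) ->
    let c : CD R n.+1 := k.1 in let d : CD R n.+1 := k.2 in
    [/\ ip c o = 0, ip d o = 0, ip a c = 0, ip ja c = 0 & cd_mul a (c - cd_mul j d) = 0].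
  move=> kA; have [c1 d1 E1 E2] := Ann_pair_eqs x0 pa.1 pja.1 kA.
  by have [] := Ann_double_eqs a0 pa c1 d1 E1 E2.
pose A := Ann ((a, ja) : CD R n.+2).
have [|U1 [U1P le1]] := dim_le_image_kernel (U := A) (W0 := Ann a) lin1.
  by move=> k /eqs[_ _ _ _ ?]; apply/mem_Ann.
have le2 : (\dim U1 <= \dim (perp s))%N.
  apply: (dim_injection lin2) => k /U1P[/eqs[c1 d1 ac jac _] /eqP].
    rewrite /f1 subr_eq0 => /eqP Ec; rewrite (mem_perp s) /= /f2.
    rewrite (ipC (cd_one R n.+1)) (ipC (cd_i R n)) c1 ac jac {1}Ec ip_mul_i cd_mul_i_i ipNr.
    by rewrite d1 oppr0 !oppr0 eqxx.
  rewrite /f1 /f2 => + c0; rewrite c0 sub0r oppr_eq0 => /eqP/(congr1 (cd_mul j)).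
  rewrite cd_mul_ii cd_mul0r => /eqP; rewrite oppr_eq0 => /eqP d0; exact: pair_ext.
by rewrite -/A; lia.
Qed.

(** (a, b) |-> (a, - b) is an automorphism of the algebra. *)
Lemma dim_Ann_neg n (a b : CD R n) :
  (\dim (Ann ((a, b) : CD R n.+1)) <= \dim (Ann ((a, - b) : CD R n.+1)))%N.
Proof.
pose f (k : CD R n.+1) : CD R n.+1 := ((k.1 : CD R n), - (k.2 : CD R n)).
have lin_f : linear f.
  by move=> s [c d] [c' d']; apply: pair_ext => //; rewrite /= opprD scalerN.
apply: (dim_injection lin_f) => -[c d].
  move/mem_Ann; rewrite cd_mul_pair => -[E1 E2]; apply/mem_Ann.
  rewrite cd_mul_pair cd_conjN !cd_mulNl cd_mulNr opprK E1 -opprD E2 oppr0 //.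
by move=> _ [-> /eqP]; rewrite oppr_eq0 => /eqP ->.
Qed.
End Count.

(** * Pairs over a composition algebra *)

Section Composition.
Variable R : realType.
Local Notation o := (cd_one R _).

Lemma cd_mulA2 : associative (@cd_mul R 2).
Proof.
move=> [[x1 x2] [x3 x4]] [[y1 y2] [y3 y4]] [[z1 z2] [z3 z4]] /=.
by apply: pair_ext; apply: pair_ext => /=; ring.
Qed.

Lemma cd_mulK_double n (mulA : associative (@cd_mul R n)) (p q : CD R n.+1) :
  cd_mul (cd_conj p) (cd_mul p q) = ip p p *: q.
Proof.
case: p q => a b [c d].
have K (u v : CD R n) : cd_mul (cd_conj u) (cd_mul u v) = ip u u *: v.
  by rewrite mulA (cd_mul_conj u).2 cd_mulZl cd_mul1l.
have K' (u v : CD R n) : cd_mul u (cd_mul (cd_conj u) v) = ip u u *: v.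
  by rewrite mulA (cd_mul_conj u).1 cd_mulZl cd_mul1l.
have M (u v : CD R n) : cd_mul v (cd_mul u (cd_conj u)) = ip u u *: v.
  by rewrite (cd_mul_conj u).1 cd_mulZr cd_mul1r.
have M' (u v : CD R n) : cd_mul v (cd_mul (cd_conj u) u) = ip u u *: v.
  by rewrite (cd_mul_conj u).2 cd_mulZr cd_mul1r.
have -> : cd_conj ((a, b) : CD R n.+1) = (cd_conj a, - b) by [].
rewrite (cd_mul_pair a) cd_mul_pair !cd_conjD !cd_conjN !cd_conjM !cd_conjK !cd_mulE -!mulA.
rewrite K K' M M' !opprK.
have -> : ip ((a, b) : CD R n.+1) ((a, b) : CD R n.+1) = ip a a + ip b b by [].
by apply: pair_ext; apply: cd_ext => w; rewrite /= !ipE; ring.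
Qed.

(** Polarized form of <p q, p q> = <p, p> <q, q>. *)
Definition composition n :=
  forall p q r : CD R n, ip (cd_mul p q) (cd_mul p r) = ip p p * ip q r.

Lemma composition_double n : associative (@cd_mul R n) -> composition n.+1.
Proof. by move=> mulA p q r; rewrite ip_mull cd_mulK_double // ipZr. Qed.

Lemma composition_r n : composition n ->
  forall p q r : CD R n, ip (cd_mul q p) (cd_mul r p) = ip p p * ip q r.
Proof. by move=> comp p q r; rewrite -ip_conj !cd_conjM comp !ip_conj. Qed.

(** If (a, b) kills (c, d) != 0, comparing norms in d b = - a c and d a = b c
gives |a| = |b| and |c| = |d|, and comparing <d a, d b> with <b c, - a c>
makes a and b orthogonal.  Then 1, a, b, a b are orthogonal to each other, and
the equations force d to be orthogonal to all four; finally d determines c. *)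
Lemma dim_Ann_composition_double n (x : CD R n.+1) : composition n -> x != 0 ->
  (\dim (Ann x) + 4 <= 2 ^ n)%N \/ Ann x = 0%VS.
Proof.
move=> compl x0; have compr := composition_r compl.
have [A0|A0] := eqVneq (Ann x) 0%VS; [by right | left].
have [k kA k0] : exists2 k, k \in Ann x & k != 0.
  by exists (vpick (Ann x)); rewrite ?memv_pick ?vpick0.
have [x1 xi] := zero_divisor_pure k0 (elimT (mem_Ann _ _) kA).
case: x x0 kA x1 xi {A0} => a b x0 kA; rewrite ip_pair1 ip_pairi => a1 b1.
have eqs := fun k => @Ann_pair_eqs R n a b k x0 a1 b1.
have [ab0 AB A0] : [/\ ip a b = 0, ip a a = ip b b & ip b b != 0].
  case: k k0 {kA} (eqs _ kA) => c d k0 [c1 d1 E1 E2].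
  have {}E1 : cd_mul d b = - cd_mul a c by apply/eqP; rewrite -addr_eq0 addrC E1.
  have N1 : ip b b * ip d d = ip a a * ip c c.
    by rewrite -compr -compl E1 ipNl ipNr opprK.
  have N2 : ip a a * ip d d = ip b b * ip c c by rewrite -compr -compl E2.
  have k_gt0 : 0 < ip c c + ip d d by have := k0; rewrite -ip_gt0.
  have x_gt0 : 0 < ip a a + ip b b by have := x0; rewrite -ip_gt0.
  have AB : ip a a = ip b b.
    apply/eqP; rewrite -subr_eq0.
    have /eqP : (ip a a - ip b b) * (ip c c + ip d d) = 0.
      by rewrite mulrDr !mulrBl N1 N2; ring.
    by rewrite mulf_eq0 (gt_eqF k_gt0) orbF.
  have A0 : ip b b != 0 by rewrite gt_eqF //; move: x_gt0; rewrite AB; lra.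
  have Ecd : ip c c = ip d d by apply: (mulfI A0); rewrite N1 AB.
  split=> //; have d_gt0 : 0 < ip d d by move: k_gt0; rewrite Ecd; lra.
  have : ip d d * ip a b = - (ip c c * ip b a).
    by rewrite -(compl d a b) -(compr c b a) E1 ipNr -[cd_mul b c]E2.
  rewrite Ecd (ipC b) => H; apply/eqP; have /eqP : ip d d * ip a b = 0 by lra.
  by rewrite mulf_eq0 (gt_eqF d_gt0).
pose f (k : CD R n.+1) : CD R n := k.2.
have lin_f : linear f by [].
pose s := [:: cd_one R n; a; b; cd_mul a b].
suff : (\dim (Ann ((a, b) : CD R n.+1)) <= \dim (perp s))%N.
  have : (\dim (perp s) + 4 <= 2 ^ n)%N.
    have ab_neq0 : ip (cd_mul a b) (cd_mul a b) != 0 by rewrite compl AB mulf_neq0.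
    have aab : ip a (cd_mul a b) = 0.
      by rewrite ipC ip_mull (cd_mul_conj a).2 ipZr b1 mulr0.
    have bab : ip b (cd_mul a b) = 0.
      by rewrite ipC ip_mulr (cd_mul_conj b).1 ipZr a1 mulr0.
    apply: dim_perp; rewrite /=.
      rewrite !(ipC (cd_one R n)) a1 b1 (ip_mul1 _ a1) ab0 aab bab oppr0 !eqxx //.
    by rewrite -!ip_eq0 ip11 oner_eq0 AB ab_neq0 A0.
  lia.
apply: (dim_injection lin_f) => -[c d] /eqs; rewrite /f => -[c1 d1 E1 E2].
  have {}E1 : cd_mul d b = - cd_mul a c by apply/eqP; rewrite -addr_eq0 addrC E1.
  have {}c1 : ip c o = 0 by []; have {}d1 : ip d o = 0 by [].
  have {}E2 : cd_mul d a = cd_mul b c by [].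
  have C : ip a c = - ip d b.
    have := congr1 (fun z => ip z o) E1; rewrite ipNl !ip_mul1 // => H; lra.
  have da : ip d a = 0.
    have : ip b b * ip d a = - (ip a a * ip c b) by rewrite -compr -compl E1 ipNl.
    have : ip d a = ip c b.
      by have := congr1 (fun z => ip z o) E2; rewrite !ip_mul1 // (ipC b) => H; lra.
    rewrite AB => <- H; apply/eqP; have /eqP : ip b b * ip d a = 0 by lra.
    by rewrite mulf_eq0 (negbTE A0).
  have db : ip d b = 0.
    have : ip a a * ip d b = ip b b * ip c a by rewrite -compr -compl E2.
    rewrite (ipC c) C AB => H; apply/eqP; have /eqP : ip b b * ip d b = 0 by lra.
    by rewrite mulf_eq0 (negbTE A0).
  have dab : ip d (cd_mul a b) = 0.
    have : ip (cd_mul d b) a = 0.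
      by rewrite E1 ipNl ip_mull (cd_mul_conj a).2 ipZr c1 mulr0 oppr0.
    by rewrite ip_mulr cd_conj_imag // cd_mulNr ipNr => /eqP; rewrite oppr_eq0 => /eqP.
  by rewrite (mem_perp s) /= !(ipC _ d) d1 da db dab eqxx.
move=> /= d0; apply: pair_ext => //=; apply/eqP; rewrite -ip_eq0.
have /eqP : ip a a * ip c c = 0.
  have {E1} : cd_mul a c = 0 by move: E1; rewrite /= d0 cd_mul0l addr0.
  by rewrite -compl => ->; rewrite ip0l.
by rewrite mulf_eq0 AB (negbTE A0).
Qed.

End Composition.

(** * The upper bound and its equality case *)

Section Bound.
Variable R : realType.
Local Notation j := (cd_i R _).

Definition Ann_bound n :=
  forall x : CD R n, x != 0 -> (\dim (Ann x) + 4 * n <= 2 ^ n + 4)%N.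

Lemma leq4_exp2 m : (4 <= m)%N -> (4 * m <= 2 ^ m)%N.
Proof.
elim: m => // m IH; rewrite leq_eqVlt => /predU1P[<- // | m4].
by rewrite expnS; have := IH m4; lia.
Qed.

Lemma Ann_bound4 : Ann_bound 4.
Proof.
move=> x x0; have [|->] := dim_Ann_composition_double (composition_double (@cd_mulA2 R)) x0.
  by rewrite -(leq_add2r 12) -!addnA.
by rewrite dimv0.
Qed.

(** Only when u or v vanishes can the bound be reached, and then dim Ann x is
controlled by dim Ann a. *)
Lemma Ann_dichotomy n (x : CD R n.+2) : (4 <= n.+1)%N -> Ann_bound n.+1 -> x != 0 ->
  (\dim (Ann x) + 4 * n.+2 < 2 ^ n.+2 + 4)%N \/
  exists a : CD R n.+1, [/\ a != 0, x = (a, cd_mul j a) \/ x = (a, - cd_mul j a) &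
    (\dim (Ann x) + 4 <= \dim (Ann a) + 2 ^ n.+1)%N].
Proof.
move=> n3 bnd x0; have := leq4_exp2 n3; rewrite (expnS _ n.+1) => le.
have [A0|A0] := eqVneq (Ann x) 0%VS; first by left; rewrite A0 dimv0; lia.
have [k kA k0] : exists2 k, k \in Ann x & k != 0.
  by exists (vpick (Ann x)); rewrite ?memv_pick ?vpick0.
have [x1 xi] := zero_divisor_pure k0 (elimT (mem_Ann _ _) kA).
have [a [b Ex]] : exists a b : CD R n.+1, x = (a, b) by exists x.1, x.2; case: (x).
move: x1 xi; rewrite {}Ex ip_pair1 ip_pairi in x0 *; clear x k kA k0 A0 => a1 b1.
have [lam|] := boolP ((ip a j != 0) || (ip b j != 0)).
  have {lam}lam : ip a j != 0 \/ ip b j != 0 by apply/orP.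
  by left; have := dim_Ann_i_component a1 b1 lam; lia.
rewrite negb_or !negbK => /andP[/eqP ai /eqP bi].
have pa : doubly_pure a by [].
have pb : doubly_pure b by [].
have [v0|v0] := eqVneq (a + cd_mul j b) 0.
  have Eb : b = cd_mul j a.
    by move/eqP: v0; rewrite addr_eq0 => /eqP ->; rewrite cd_mulNr cd_mul_ii opprK.
  have a0 : a != 0 by apply: contra x0 => /eqP a0; rewrite Eb a0 cd_mul0r.
  right; exists a; split=> //; rewrite Eb; [by left | exact: dim_Ann_double].
have [u0|u0] := eqVneq (a - cd_mul j b) 0.
  have Eb : b = - cd_mul j a.
    by move/eqP: u0; rewrite subr_eq0 => /eqP ->; rewrite cd_mul_ii opprK.
  have a0 : a != 0 by apply: contra x0 => /eqP a0; rewrite Eb a0 cd_mul0r oppr0.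
  right; exists a; split=> //; [by right; rewrite Eb|].
  apply: leq_trans (dim_Ann_double pa a0); rewrite leq_add2r.
  by apply: leq_trans (dim_Ann_neg _ _) _; rewrite Eb opprK.
left; have := dim_Ann_pure pa pb x0; have := bnd _ u0; have := bnd _ v0; lia.
Qed.

Lemma Ann_bound_ge4 n : (4 <= n)%N -> Ann_bound n.
Proof.
elim: n => // n IH; rewrite leq_eqVlt => /predU1P[<-|n4]; first exact: Ann_bound4.
case: n IH n4 => // n IH n4 x x0; have bnd := IH n4.
have [/ltnW //|[a [a0 _ le]]] := Ann_dichotomy n4 bnd x0.
by have := bnd a a0; rewrite (expnS _ n.+1); lia.
Qed.

End Bound.

Theorem proposition15p6 (R : realType) (m : nat) (hn : (5 <= m.+2)%N)
    (x : CD R m.+2) (hx : top_dimensional_zero_divisor x) :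
  exists2 a : CD R m.+1, top_dimensional_zero_divisor a &
    x = (a, cd_mul (cd_i R m) a) \/ x = (a, - cd_mul (cd_i R m) a).
Proof.
have topE n (y : CD R n) :
    top_dimensional_zero_divisor y <-> (\dim (Ann y) + 4 * n = 2 ^ n + 4)%N.
  have E : 2 ^+ n = (2 ^ n)%N :> int by rewrite -natz natrX.
  by rewrite /top_dimensional_zero_divisor E; split=> H; lia.
move/topE: hx => hx.
have m4 : (4 <= m.+1)%N by [].
have bnd := Ann_bound_ge4 m4.
have x0 : x != 0.
  apply/eqP => x0; have A : \dim (Ann x) = (2 ^ m.+2)%N.
    rewrite -(dim_CD R m.+2); congr (\dim _); apply/vspaceP => y.
    by rewrite memvf x0; apply/mem_Ann; rewrite cd_mul0l.
  by move: hx; rewrite A; lia.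
have [lt|[a [a0 Ex le]]] := Ann_dichotomy m4 (bnd R) x0; first by lia.
by exists a => //; apply/topE; have := bnd R a a0; move: hx le; rewrite (expnS _ m.+1); lia.
Qed.
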